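(* Let $(f_n)_{n\in\mathbb N}$ and $(g_n)_{n\in\mathbb N}$ be countable dense sequences in $C[0,1]$, and let $p,p'\in(0,1)$. Suppose that graphs sampled from $\mathrm{LARG}(\{f_n\},p)$ and $\mathrm{LARG}(\{g_n\},p')$ are almost surely isomorphic. Then there exist a homeomorphism $\psi$ of $[0,1]$ onto itself and a permutation $i\mapsto n_i$ of $\mathbb N$ such that one of the following holds: (1) for all $i,j$ and all $x\in[0,1]$, if $f_i(x)>f_j(x)$ then $g_{n_i}(\psi(x))\ge g_{n_j}(\psi(x))$; or (2) for all $i,j$ and all $x\in[0,1]$, if $f_i(x)>f_j(x)$ then $g_{n_i}(\psi(x))\le g_{n_j}(\psi(x))$.
   Context: $C[0,1]$ is the Banach space of continuous real functions on $[0,1]$ with the sup norm $\|\cdot\|$. For countable $V\subseteq C[0,1]$ and $p\in(0,1)$, $\mathrm{LARG}(V,p)$ is the random graph on $V$ in which each pair $u\neq v$ with $\|u-v\|<1$ is joined independently with probability $p$, and no other pairs are joined.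
   Formalization: The sequences (f_n) and (g_n) are assumed to have no repeated terms, since with repetitions the claimed permutation of indices can fail to exist; ''almost surely isomorphic'' is read for two independent samples. *)

(* Defs.v *)
From HB Require Import structures.
From mathcomp Require Export all_boot all_order all_algebra.
From mathcomp Require Export all_classical all_reals all_analysis.

Set Implicit Arguments.
Unset Strict Implicit.
Unset Printing Implicit Defensive.

Import Order.TTheory GRing.Theory Num.Theory.
Import numFieldNormedType.Exports.

Local Open Scope classical_set_scope.
Local Open Scope ring_scope.

(* [0,1] as a type, with the topology induced from R. *)
Definition unit_interval (R : realType) := set_type `[(0 : R), (1 : R)]%classic.
HB.instance Definition _ (R : realType) := Topological.on (unit_interval R).

Definition C01 (R : realType) := continuousType (unit_interval R) R.
HB.instance Definition _ (R : realType) := Choice.on (C01 R).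

Definition supnorm (R : realType) (h : unit_interval R -> R) : R :=
  sup (range (fun x => `|h x|)).

(* ||u - v||; the difference is taken pointwise as C01 carries no ring or
   module structure in the library. *)
Definition C01_dist (R : realType) (u v : C01 R) : R :=
  supnorm (fun x => u x - v x).

Definition C01_dense (R : realType) (V : set (C01 R)) : Prop :=
  forall (u : C01 R) (e : R), 0 < e -> exists2 v, V v & C01_dist v u < e.

Definition homeomorphism (X Y : topologicalType) (h : X -> Y) : Prop :=
  continuous h /\
  exists k : Y -> X, [/\ continuous k, cancel h k & cancel k h].

Section LARG.
Context (R : realType).

Definition larg_pair (V : set (C01 R)) (e : C01 R * C01 R) : Prop :=
  [/\ V e.1, V e.2, e.1 != e.2 & C01_dist e.1 e.2 < 1].

(* No unordered pair is listed twice, in either orientation. *)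
Definition distinct_pairs (s : seq (C01 R * C01 R)) : bool :=
  pairwise (fun e e' => (e != e') && (e != (e'.2, e'.1))) s.

Definition edge_event (T : Type) (G : T -> rel (C01 R)) (e : C01 R * C01 R) :
    set T :=
  [set w | G w e.1 e.2].

(* G is a random graph with law LARG(V, p), given by its random adjacency
   relation on C[0,1], which is supported on pairs of vertices in V. *)
Definition is_LARG (d : measure_display) (T : measurableType d)
    (P : probability T R) (V : set (C01 R)) (p : R)
    (G : T -> rel (C01 R)) : Prop :=
  [/\ (forall w, symmetric (G w)),
      (forall w u v, G w u v -> larg_pair V (u, v)),
      (forall e, larg_pair V e -> measurable (edge_event G e)),
      (forall e, larg_pair V e -> P (edge_event G e) = p%:E)
    & (forall s : seq (C01 R * C01 R),
         (forall e, e \in s -> larg_pair V e) -> distinct_pairs s ->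
         P (\bigcap_(e in [set` s]) edge_event G e) =
         (\prod_(e <- s) P (edge_event G e))%E)].

Definition graph_iso (V : set (C01 R)) (E : rel (C01 R))
    (W : set (C01 R)) (F : rel (C01 R)) : Prop :=
  exists phi : C01 R -> C01 R, set_bij V W phi /\
    forall u v, V u -> V v -> E u v = F (phi u) (phi v).

(* Independent samples, realized on a product space.  The almost-everywhere
   quantifier only asks that the exceptional set be contained in a measurable
   null set: the event itself need not be measurable. *)
Definition as_isomorphic (d1 d2 : measure_display)
    (T1 : measurableType d1) (T2 : measurableType d2)
    (P1 : probability T1 R) (P2 : probability T2 R)
    (V : set (C01 R)) (G : T1 -> rel (C01 R))
    (W : set (C01 R)) (H : T2 -> rel (C01 R)) : Prop :=
  {ae (P1 \x P2)%E, forall w : T1 * T2, graph_iso V (G w.1) W (H w.2)}.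

End LARG.

(* Main.v *)
(** Let V be dense.  Almost surely, two distinct vertices of LARG(V, p) have a
common neighbour exactly when they are at distance less than 2: each of the
infinitely many vertices at distance less than 1 from both is joined to both
with probability p^2, independently of the others.  So an isomorphism preserves
the relation [dist u v < 2] and, chaining such steps through V, all balls of
radius 2k.

Call a set of vertices a horoball if each of its finite subsets lies in a ball
contained in the set.  The half-spaces [u x > t] and [u x < t] are horoballs,
and by compactness every proper horoball is contained in one of them.
Half-spaces attached to different pairs (point, sign) are incomparable, so the
half-spaces are exactly the proper horoballs whose proper horoball supersets
form a chain.  Hence an isomorphism permutes half-spaces, and this induces a
permutation of the pairs (point, sign).  The sign is constant by connectedness,
and the map on points is continuous because the sets [u < v], for u, v in the
dense family, form a base of the topology. *)

From HB Require Import structures.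
Require Import Defs.
From mathcomp Require Import ring lra.

Import Order.TTheory GRing.Theory Num.Theory.
Import numFieldNormedType.Exports.

Local Open Scope classical_set_scope.
Local Open Scope ring_scope.

Set Implicit Arguments.
Unset Strict Implicit.

Lemma open_continuous_lt (R : realType) (T : topologicalType) (u v : T -> R) :
  continuous u -> continuous v -> open [set x | u x < v x].
Proof.
move=> u_cont v_cont.
rewrite (_ : mkset _ = (v \- u) @^-1` [set t | 0 < t]); last first.
  by apply/seteqP; split=> x /=; rewrite subr_gt0.
by apply: open_comp (open_gt (y := 0)) => x _; apply: cvgB;
  [exact: v_cont|exact: u_cont].
Qed.

Lemma injective_continuous_hausdorff (S T : topologicalType) (h : S -> T) :
  hausdorff_space T -> continuous h -> injective h -> hausdorff_space S.
Proof.
move=> T_hausdorff h_cont h_inj x y xy; apply/h_inj/T_hausdorff => A B.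
by move=> /h_cont hA /h_cont hB; have [z [Az Bz]] := xy _ _ hA hB; exists (h z).
Qed.

Lemma connected_constant_sign (R : realType) (T : topologicalType)
    (h : T -> R) :
  connected [set: T] -> continuous h -> (forall x, h x != 0) ->
  (forall x, 0 < h x) \/ (forall x, h x < 0).
Proof.
move=> T_connected h_cont h_neq0.
have [[x hx]|no_pos] := pselect (exists x, 0 < h x); last first.
  right=> x; rewrite lt_neqAle h_neq0 leNgt; apply/negP => hx.
  by apply: no_pos; exists x.
left=> y; suff : [set z | 0 < h z] y by [].
have -> // : [set z | 0 < h z] = setT.
apply: T_connected; first by exists x.
- exists [set z | 0 < h z]; last by rewrite setTI.
  by apply: open_continuous_lt h_cont; exact: cst_continuous.
- exists [set z | 0 <= h z].
    by apply: closed_comp (closed_ge (y := 0)) => z _; exact: h_cont.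
  by rewrite setTI; apply/seteqP; split=> z /=; rewrite [0 < _]lt0r h_neq0.
Qed.

Definition compact_hausdorff (T : topologicalType) : Prop :=
  compact [set: T] /\ hausdorff_space T.

Section compact_spaces.
Context (R : realType) (K : ptopologicalType).
Hypothesis K_compact : compact [set: K].
Implicit Types h : K -> R.

Lemma compact_attains_max h : continuous h -> exists c, forall x, h x <= h c.
Proof.
move=> h_cont.
have [||c _ hc] := @compact_EVT_max K R h setT _ K_compact.
- by exists point.
- exact: continuous_subspaceT.
by exists c => x; apply: hc; rewrite inE.
Qed.

Lemma compact_lt_natmul h (r : R) : continuous h -> 0 < r ->
  exists k : nat, forall x, h x < r * k.+1%:R.
Proof.
move=> /compact_attains_max[c hc] r_gt0.
exists (Num.truncn (h c / r)) => x; apply: le_lt_trans (hc x) _.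
by rewrite mulrC -ltr_pdivrMr // truncnS_gt.
Qed.

Lemma compact_finite_subcover (I : choiceType) (D : set I) (U : I -> set K) :
  (forall i, D i -> open (U i)) -> (forall x, exists2 i, D i & U i x) ->
  exists s : seq I, {subset s <= D} /\ forall x, exists2 i, i \in s & U i x.
Proof.
move=> U_open U_cover.
have [s s_sub s_cover] : finite_subset_cover D U setT.
  move: K_compact; rewrite compact_cover; apply=> // x _.
  by have [i] := U_cover x; exists i.
by exists (finmap.enum_fset s); split=> [i /s_sub|x] //; exact: s_cover.
Qed.

End compact_spaces.

Lemma compact_hausdorff_separation (R : realType) (T : topologicalType) (x : T)
    (N : set T) : compact_hausdorff T -> nbhs x N ->
  exists2 phi : T -> R, continuous phi &
    phi x = 0 /\ forall y, ~ N y -> phi y = 1.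
Proof.
move=> [T_compact T_hausdorff] Nx.
have T_regular : completely_regular_space T.
  apply: (normal_completely_regular (R := R)).
    exact: compact_normal.
  exact: hausdorff_accessible.
have /(uniform_separatorP (R := R))[phi [phi_cont _ phi0 phi1]] :
    uniform_separator [set x] (~` N°).
  by apply: T_regular; [exact/open_closedC/open_interior|exact].
exists phi => //; split=> [|y nNy]; first by apply: phi0; exists x.
by apply: phi1; exists y => // /interior_subset.
Qed.

Section dense_families.
Context (R : realType) (K : ptopologicalType) (I : Type).
Implicit Types (f : I -> K -> R) (u v l m : K -> R) (r s : R).

Definition uniformly_within r u v := forall x : K, `|u x - v x| < r.

Definition dense_family f := (forall i, continuous (f i)) /\
  forall u r, continuous u -> 0 < r -> exists i, uniformly_within r (f i) u.

Definition proximity r f (i j : I) : Prop := uniformly_within r (f i) (f j).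

Definition flip (b : bool) f (i : I) (x : K) : R := (-1) ^+ b * f i x.

Lemma sup_dist_lt r u v : compact [set: K] -> continuous u -> continuous v ->
  sup (range (fun x => `|u x - v x|)) < r <-> uniformly_within r u v.
Proof.
move=> K_compact u_cont v_cont.
have [|c c_max] := compact_attains_max K_compact (h := fun x => `|u x - v x|).
  move=> x; apply: cvg_norm.
  by apply: cvgB; [exact: u_cont|exact: v_cont].
suff -> : sup (range (fun x => `|u x - v x|)) = `|u c - v c|.
  by split=> // + x; apply: le_lt_trans; exact: c_max.
apply/eqP; rewrite eq_le; apply/andP; split.
  by apply: sup_le_ub => [|_ [x _ <-]]; [exists `|u c - v c|, c|exact: c_max].
apply: ub_le_sup; first by exists `|u c - v c| => _ [x _ <-]; exact: c_max.
by exists c.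
Qed.

Lemma proximity_flip r b f : proximity r (flip b f) = proximity r f.
Proof.
apply/funext => i; apply/funext => j; apply/propext.
by split=> ij x; have := ij x; rewrite -mulrBr normrMsign.
Qed.

Lemma continuous_sign_mul (b : bool) u :
  continuous u -> continuous (fun x => (-1) ^+ b * u x).
Proof.
by move=> u_cont x; apply: cvgM; [exact: cvg_cst|exact: u_cont].
Qed.

Lemma dense_family_flip b f : dense_family f -> dense_family (flip b f).
Proof.
move=> [f_cont f_dense]; split=> [i|u r u_cont r0].
  exact/continuous_sign_mul/f_cont.
have [i fi] := f_dense _ _ (continuous_sign_mul (b := b) u_cont) r0.
by exists i => x; rewrite -[u x](signrMK b) -mulrBr normrMsign.
Qed.

Lemma dense_family_bij f (n : I -> I) :
  bijective n -> dense_family f -> dense_family (f \o n).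
Proof.
move=> [n' _ n'K] [f_cont f_dense]; split=> [i|u r u_cont r0].
  exact: f_cont.
by have [i fi] := f_dense u r u_cont r0; exists (n' i); rewrite /= n'K.
Qed.

Context (f : I -> K -> R) (f_dense : dense_family f).
Hypothesis K_compact : compact [set: K].

Lemma dense_sandwich l m : continuous l -> continuous m ->
  (forall x, l x < m x) -> exists i, forall x, l x < f i x < m x.
Proof.
move=> l_cont m_cont lm.
have [x0 gap] : exists x0, forall x, l x - m x <= l x0 - m x0.
  apply: (compact_attains_max K_compact) => x.
  by apply: cvgB; [exact: l_cont|exact: m_cont].
have gap0 := lm x0; have [||i fi] := f_dense.2 (fun x => (l x + m x) / 2)
  ((m x0 - l x0) / 2).
- move=> x; apply: cvgM; last exact: cvg_cst.
  by apply: cvgD; [exact: l_cont|exact: m_cont].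
- lra.
by exists i => x; have := fi x; have := gap x; rewrite ltr_norml; lra.
Qed.

End dense_families.

Section infinitely_many.
Context (R : realType) (K : ptopologicalType) (I : choiceType).
Context (f : I -> K -> R) (f_dense : dense_family f).
Hypothesis K_compact : compact [set: K].
Implicit Types (u v l m : K -> R) (r s : R).

(* If finitely many [f i] lay between [l] and [m], raising [l] close to [m]
   would give one exceeding all of them at [point]. *)
Lemma infinite_dense_sandwich l m : continuous l -> continuous m ->
  (forall x, l x < m x) ->
  infinite_set [set i | forall x, l x < f i x < m x].
Proof.
move=> l_cont m_cont lm /finite_seqP[s sE].
have s_mem i : i \in s <-> forall x, l x < f i x < m x.
  by have /predeqP/(_ i) /= [] := sE.
pose top := \big[Num.max/l point]_(i <- s) f i point.
have top_lt : top < m point.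
  rewrite /top big_seq; apply: bigmax_lt => // i.
  by move=> /s_mem/(_ point)/andP[].
have [||x|j j_above] := dense_sandwich f_dense K_compact
    (l := l \max (fun x => m x - (m point - top))) (m := m) => //.
- move=> x; apply: continuous_max; first exact: l_cont.
  by apply: cvgB; [exact: m_cont|exact: cvg_cst].
- by rewrite gt_max lm; lra.
have js : j \in s.
  apply/s_mem => x.
  by have := j_above x; rewrite gt_max => /andP[/andP[-> _] ->].
have := j_above point; rewrite gt_max subKr => /andP[/andP[_]].
by rewrite ltNge le_bigmax_seq.
Qed.

Lemma dense_intermediate r s u v : continuous u -> continuous v ->
  uniformly_within (r + s) u v -> 0 < r -> 0 < s ->
  infinite_set [set i | uniformly_within r u (f i) /\
                        uniformly_within s (f i) v].
Proof.
move=> u_cont v_cont uv r0 s0.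
apply: (sub_infinite_set _ (infinite_dense_sandwich
  (l := (fun x => u x - r) \max (fun x => v x - s))
  (m := (fun x => u x + r) \min (fun x => v x + s)) _ _ _)) => [i fi|||].
- split=> x; have := fi x; rewrite gt_max lt_min ltr_norml; lra.
- move=> x; apply: continuous_max; apply: cvgB;
  by [exact: u_cont|exact: v_cont|exact: cvg_cst].
- move=> x; apply: continuous_min; apply: cvgD;
  by [exact: u_cont|exact: v_cont|exact: cvg_cst].
by move=> x; have := uv x; rewrite gt_max !lt_min ltr_norml; lra.
Qed.

End infinitely_many.

Section horoballs.
Context (I : choiceType) (E : I -> I -> Prop).
Implicit Types H : set I.

(* [walk k i] is the graph ball of radius [k + 1] around [i]. *)
Fixpoint walk (k : nat) (i j : I) : Prop :=
  if k is k'.+1 then exists l, E i l /\ walk k' l j else E i j.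

Definition horoball H := forall s : seq I, [set` s] `<=` H ->
  exists a k, [set` s] `<=` walk k a /\ walk k a `<=` H.

Definition proper_horoball H := horoball H /\ exists i, ~ H i.

Definition chain_horoball H := proper_horoball H /\
  forall H1 H2, proper_horoball H1 -> proper_horoball H2 ->
    H `<=` H1 -> H `<=` H2 -> H1 `<=` H2 \/ H2 `<=` H1.

End horoballs.

Section proximity_horoballs.
Context (R : realType) (K : ptopologicalType) (I : choiceType).
Context (f : I -> K -> R) (r : R).
Hypothesis K_compact : compact [set: K].
Hypothesis f_dense : dense_family f.
Hypothesis r_gt0 : 0 < r.
Local Notation E := (proximity r f).
Implicit Types H : set I.

Lemma walk_proximity k : walk E k = proximity (r * k.+1%:R) f.
Proof.
elim: k => [|k IH]; first by rewrite mulr1.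
apply/funext => i; apply/funext => j; apply/propext => /=; rewrite IH.
split=> [[l [il lj]] x|ij].
  have := ler_distD (f l x) (f i x) (f j x); have := il x; have := lj x.
  by rewrite -(natr1 k.+1); lra.
have rk_gt0 : 0 < r * k.+1%:R by rewrite mulr_gt0.
have : uniformly_within (r + r * k.+1%:R) (f i) (f j).
  by rewrite -{1}[r]mulr1 -mulrDr nat1r.
by move=> /(dense_intermediate f_dense K_compact (f_dense.1 i) (f_dense.1 j));
  move=> /(_ r_gt0 rk_gt0)/infinite_setN0[l il]; exists l.
Qed.

Lemma superlevel_horoball x t : horoball E [set i | t < f i x].
Proof.
move=> s s_above.
pose low y := \big[Num.min/t + 1]_(i <- s) f i y.
pose high y := \big[Num.max/t + 1]_(i <- s) f i y.
have low_cont : continuous low.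
  by apply: continuous_big => [|i _]; [exact: min_continuous|exact: f_dense.1].
have high_cont : continuous high.
  by apply: continuous_big => [|i _]; [exact: max_continuous|exact: f_dense.1].
have low_gt : t < low x.
  rewrite /low big_seq; apply: lt_bigmin => [|i /s_above //].
  by rewrite ltrDl.
have [|k width_lt] := compact_lt_natmul K_compact (h := high \- low) _ r_gt0.
  by move=> y; apply: cvgB; [exact: high_cont|exact: low_cont].
pose q := r * k.+1%:R.
have q_gt0 : 0 < q by rewrite mulr_gt0.
have [|||a a_near] := dense_sandwich f_dense K_compact
    (l := (fun y => high y - q) \max (fun y => low y + (q - (low x - t))))
    (m := fun y => low y + q).
- move=> y; apply: continuous_max.
    by apply: cvgB; [exact: high_cont|exact: cvg_cst].
  by apply: cvgD; [exact: low_cont|exact: cvg_cst].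
- by move=> y; apply: cvgD; [exact: low_cont|exact: cvg_cst].
- by move=> y; have := width_lt y; rewrite gt_max -/q /=; lra.
exists a, k; rewrite walk_proximity -/q; split=> i.
  move=> /= si y; have := a_near y; rewrite gt_max ltr_norml.
  have : low y <= f i y by exact: ge_bigmin_seq.
  have : f i y <= high y by exact: le_bigmax_seq.
  lra.
move=> /(_ x); have := a_near x; rewrite gt_max ltr_norml /=; lra.
Qed.

Lemma horoball_no_minimum H i : horoball E H -> H i ->
  exists2 j, H j & forall x, f j x < f i x.
Proof.
move=> H_horoball Hi; have [|a [k []]] := H_horoball [:: i].
  by move=> j /=; rewrite inE => /eqP ->.
rewrite walk_proximity => /(_ i (mem_head _ _)) ai ball_sub.
have [|||j j_between] := dense_sandwich f_dense K_compact
    (l := fun x => f a x - r * k.+1%:R) (m := f i).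
- by move=> x; apply: cvgB; [exact: f_dense.1|exact: cvg_cst].
- exact: f_dense.1.
- by move=> x; have := ai x; rewrite ltr_norml; lra.
exists j => [|x]; last by case/andP: (j_between x).
apply: ball_sub => x; have := ai x; have := j_between x.
by rewrite !ltr_norml; lra.
Qed.

End proximity_horoballs.

Section halfspaces.
Context (R : realType) (K : ptopologicalType).

(* [(x, b)] stands for evaluation at [x], negated when [b] is true. *)
Definition direction : Type := (K * bool)%type.
Implicit Types (d : direction) (u : K -> R).

Definition along d u : R := (-1) ^+ d.2 * u d.1.
Definition opposite d : direction := (d.1, ~~ d.2).

Lemma oppositeK : involutive opposite.
Proof. by case=> x b; rewrite /opposite negbK. Qed.

Lemma along_opposite d u : along (opposite d) u = - along d u.
Proof. by rewrite /along signrN mulNr. Qed.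

Definition halfspace (I : Type) (f : I -> K -> R) d (t : R) : set I :=
  [set i | t < along d (f i)].

Context (I : choiceType) (f : I -> K -> R) (r : R).
Hypothesis K_ch : compact_hausdorff K.
Hypothesis f_dense : dense_family f.
Hypothesis r_gt0 : 0 < r.
Local Notation E := (proximity r f).
Implicit Types (H : set I) (t : R).

Lemma exists_along_gt d1 d2 t1 t2 : d2 <> opposite d1 ->
  exists2 u, continuous u & t1 < along d1 u /\ t2 < along d2 u.
Proof.
case: d1 d2 => x b [y c]; rewrite /along /opposite /= => not_opp.
have [xy|/eqP xy] := eqVneq x y.
  have bc : c = b by case: b c not_opp => -[] //; rewrite xy.
  exists (cst ((-1) ^+ b * (Num.max t1 t2 + 1))); first exact: cst_continuous.
  by rewrite bc /= !signrMK; split; rewrite ltr_pwDr // le_max lexx ?orbT.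
have Nx : nbhs x (~` [set y]).
  apply: open_nbhs_nbhs; split=> //; apply/closed_openC.
  exact/accessible_closed_set1/hausdorff_accessible/K_ch.2.
have [phi phi_cont [phix phi1]] :=
  compact_hausdorff_separation R K_ch Nx.
pose v1 := (-1) ^+ b * (t1 + 1); pose v2 := (-1) ^+ c * (t2 + 1).
exists (fun z => v1 + (v2 - v1) * phi z) => [z|].
  apply: cvgD; first exact: cvg_cst.
  by apply: cvgM; [exact: cvg_cst|exact: phi_cont].
rewrite phix phi1; last by apply.
by rewrite mulr0 mulr1 addr0 subrKC !signrMK !ltrDl.
Qed.

Lemma halfspace_meet d1 d2 t1 t2 : d2 <> opposite d1 ->
  halfspace f d1 t1 `&` halfspace f d2 t2 !=set0.
Proof.
move=> /(exists_along_gt t1 t2)[u u_cont [u1 u2]].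
have [|i fi] :=
    f_dense.2 u (Num.min (along d1 u - t1) (along d2 u - t2)) u_cont.
  by rewrite lt_min !subr_gt0 u1.
have above d t : `|f i d.1 - u d.1| < along d u - t -> halfspace f d t i.
  by rewrite -(normrMsign d.2) mulrBr /halfspace /along /= ltr_norml; lra.
exists i; split; apply: above.
  by have := fi d1.1; rewrite lt_min => /andP[].
by have := fi d2.1; rewrite lt_min => /andP[].
Qed.

Lemma halfspace_sub_direction d1 d2 t1 t2 :
  halfspace f d1 t1 `<=` halfspace f d2 t2 -> d1 = d2.
Proof.
move=> sub; apply: contrapT => d12.
have [|i [/sub]] := @halfspace_meet d1 (opposite d2) t1 (- t2).
  by move=> /(can_inj oppositeK)/esym.
rewrite /halfspace /= along_opposite ltrN2 => /lt_trans /[apply].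
by rewrite ltxx.
Qed.

Lemma halfspace_le d t1 t2 : t1 <= t2 -> halfspace f d t2 `<=` halfspace f d t1.
Proof. by move=> t12 i; exact: le_lt_trans. Qed.

Lemma halfspace_proper_horoball d t : proper_horoball E (halfspace f d t).
Proof.
split.
  rewrite -(proximity_flip r d.2).
  have flip_dense := dense_family_flip d.2 f_dense.
  exact: (@superlevel_horoball _ _ _ _ _ K_ch.1 flip_dense r_gt0 d.1 t).
have [|i [/ltW]] := @halfspace_meet (opposite d) (opposite d) (- t) (- t).
  by case: d => x [].
by rewrite along_opposite lerN2 => it _; exists i; apply/negP; rewrite -leNgt.
Qed.

Lemma horoball_no_minimum_along H d i : horoball E H -> H i ->
  exists2 j, H j & along d (f j) < along d (f i).
Proof.
rewrite -(proximity_flip r d.2) => H_horoball Hi.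
have flip_dense := dense_family_flip d.2 f_dense.
have [j Hj ji] :=
  horoball_no_minimum K_ch.1 flip_dense r_gt0 H_horoball Hi.
by exists j; last exact: ji.
Qed.

Lemma horoball_supporting_direction H i : horoball E H -> ~ H i ->
  exists d, forall j, H j -> along d (f i) <= along d (f j).
Proof.
move=> H_horoball nHi; apply: contrapT => no_support; apply: nHi.
have below b : exists s : seq I, [set` s] `<=` H /\
    forall x, exists2 j, j \in s & along (x, b) (f j) < along (x, b) (f i).
  have [j Hj|x|s [sH s_below]] := @compact_finite_subcover K K_ch.1 I H
      (fun j => [set x | along (x, b) (f j) < along (x, b) (f i)]).
  - by apply: open_continuous_lt; apply: continuous_sign_mul; exact: f_dense.1.
  - apply: contrapT => none; apply: no_support; exists (x, b) => j Hj.
    by rewrite leNgt; apply/negP => ji; apply: none; exists j.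
  - by exists s; split=> // j /sH; rewrite inE.
have [s [sH s_below]] := below false; have [t [tH t_below]] := below true.
have [|a [k []]] := H_horoball (s ++ t).
  by move=> j /=; rewrite mem_cat => /orP[/sH|/tH].
rewrite (walk_proximity K_ch.1 f_dense r_gt0) => ball_sup; apply => x.
have [j js] := s_below x; have [l lt] := t_below x.
have /(_ x) : proximity (r * k.+1%:R) f a j.
  by apply: ball_sup; rewrite /= mem_cat js.
have /(_ x) : proximity (r * k.+1%:R) f a l.
  by apply: ball_sup; rewrite /= mem_cat lt orbT.
rewrite /along /= expr0 expr1 !mul1r !mulN1r !ltr_norml; lra.
Qed.

Lemma proper_horoball_sub_halfspace H : proper_horoball E H ->
  exists d t, H `<=` halfspace f d t.
Proof.
move=> [H_horoball [i nHi]].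
have [d di] := horoball_supporting_direction H_horoball nHi.
exists d, (along d (f i) - 1) => j /di; rewrite /halfspace /=; lra.
Qed.

Lemma horoball_halfspaceE H d t : horoball E H -> H `<=` halfspace f d t ->
  (forall d' t', H `<=` halfspace f d' t' -> d' = d) ->
  exists t', H = halfspace f d t'.
Proof.
move=> H_horoball H_sub only_d.
pose values := [set along d (f i) | i in H].
have values_inf : has_inf values.
  split; last by exists t => _ [i /H_sub + <-]; exact: ltW.
  have [//|a [k [_ ball_sub]]] := H_horoball [::].
  exists (along d (f a)), a => //; apply: ball_sub.
  rewrite (walk_proximity K_ch.1 f_dense r_gt0) => x.
  by rewrite subrr normr0 mulr_gt0.
exists (inf values); apply/seteqP; split=> i /=.
  move=> Hi; have [j Hj] := horoball_no_minimum_along d H_horoball Hi.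
  by apply: le_lt_trans; apply: inf_lbound; [case: values_inf|exists j].
move=> inf_lt; apply: contrapT => nHi.
have [d' d'i] := horoball_supporting_direction H_horoball nHi.
have d'd : d' = d.
  apply: (only_d _ (along d' (f i) - 1)) => j /d'i; rewrite /halfspace /=; lra.
move: inf_lt; rewrite /halfspace /= ltNge => /negP; apply.
apply: lb_le_inf; first by case: values_inf.
by move=> _ [j Hj <-]; rewrite -d'd; exact: d'i.
Qed.

Lemma halfspace_superset H d t : proper_horoball E H ->
  halfspace f d t `<=` H -> exists t', H = halfspace f d t'.
Proof.
move=> H_proper sub_H.
have [d' [t' Hd']] := proper_horoball_sub_halfspace H_proper.
have only_d d2 t2 : H `<=` halfspace f d2 t2 -> d2 = d.
  by move=> Hd2; have/esym := halfspace_sub_direction (subset_trans sub_H Hd2).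
have d'd := only_d _ _ Hd'; rewrite d'd in Hd'.
exact: (horoball_halfspaceE H_proper.1 Hd' only_d).
Qed.

Lemma chain_horoballP H :
  chain_horoball E H <-> exists d t, H = halfspace f d t.
Proof.
split=> [[H_proper chain]|[d [t ->]]].
  have [d [t Hd]] := proper_horoball_sub_halfspace H_proper.
  exists d; apply: (horoball_halfspaceE H_proper.1 Hd) => d' t' Hd'.
  by have [/halfspace_sub_direction|/halfspace_sub_direction] :=
    chain _ _ (halfspace_proper_horoball d t)
      (halfspace_proper_horoball d' t') Hd Hd'.
split=> [|H1 H2 proper1 proper2]; first exact: halfspace_proper_horoball.
move=> /(halfspace_superset proper1)[t1 ->].
move=> /(halfspace_superset proper2)[t2 ->].
by have [/halfspace_le|/ltW/halfspace_le] := leP t1 t2; [right|left].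
Qed.

End halfspaces.

Section direction_maps.
Context (R : realType) (I : choiceType).

Definition direction_map (K L : ptopologicalType) (f : I -> K -> R)
    (g : I -> L -> R) (F : direction K -> direction L) : Prop :=
  forall d t, exists t', halfspace f d t = halfspace g (F d) t'.

Context (K L : ptopologicalType) (f : I -> K -> R) (g : I -> L -> R).
Hypothesis K_ch : compact_hausdorff K.
Hypothesis L_ch : compact_hausdorff L.
Hypothesis f_dense : dense_family f.
Hypothesis g_dense : dense_family g.

Lemma direction_map_exists (r s : R) : 0 < r -> 0 < s ->
  proximity r f = proximity s g -> exists F, direction_map f g F.
Proof.
move=> r_gt0 s_gt0 fg.
have image d t : exists d' t', halfspace f d t = halfspace g d' t'.
  apply/(chain_horoballP L_ch g_dense s_gt0); rewrite -fg.
  by apply/(chain_horoballP K_ch f_dense r_gt0); exists d, t.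
have [F F0] := choice (fun d => image d 0).
exists F => d t; have [t0 d0] := F0 d; have [d' [t' d't']] := image d t.
suff -> : F d = d' by exists t'.
have direction_eq := halfspace_sub_direction L_ch g_dense.
have [t_le0|/ltW t_ge0] := leP t 0.
  by apply: (direction_eq _ _ t0 t'); rewrite -d0 -d't'; exact: halfspace_le.
by apply/esym/(direction_eq _ _ t' t0); rewrite -d0 -d't'; exact: halfspace_le.
Qed.

Lemma direction_mapK F F' :
  direction_map f g F -> direction_map g f F' -> cancel F F'.
Proof.
move=> FP F'P d; have [t dt] := FP d 0; have [t' dt'] := F'P (F d) t.
have direction_eq := halfspace_sub_direction K_ch f_dense.
by apply/esym/(direction_eq _ _ 0 t'); rewrite dt dt'.
Qed.

Lemma direction_map_opposite F : direction_map f g F ->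
  forall d, F (opposite d) = opposite (F d).
Proof.
move=> FP d; apply: contrapT => not_opp.
have [t dt] := FP d 0; have [t' dt'] := FP (opposite d) 0.
have [i] := halfspace_meet L_ch g_dense t t' not_opp.
rewrite -dt -dt' => -[]; rewrite /halfspace /= along_opposite oppr_gt0.
by move=> /lt_trans /[apply]; rewrite ltxx.
Qed.

Lemma direction_map_lt F d i j : direction_map f g F ->
  along d (f j) < along d (f i) -> along (F d) (g j) < along (F d) (g i).
Proof.
move=> FP ji; have [t /seteqP[sub sup]] := FP d (along d (f j)).
by apply: le_lt_trans (sub i ji); rewrite leNgt; apply/negP => /sup /=;
  rewrite /halfspace /= ltxx.
Qed.

Lemma direction_map_point_surj F F' (y : L) :
  direction_map f g F -> cancel F' F -> exists x, (F (x, false)).1 = y.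
Proof.
move=> FP F'K; case F'y : (F' (y, false)) => [x c]; exists x.
have {F'y} : F (x, c) = (y, false) by rewrite -F'y F'K.
case: c => [|-> //]; rewrite -[(x, true)]/(opposite (x, false)).
by rewrite direction_map_opposite //; case: (F _) => z b /= [].
Qed.

Lemma direction_map_sign F F' : connected [set: L] ->
  direction_map f g F -> cancel F' F ->
  exists b, forall x, (F (x, false)).2 = b.
Proof.
move=> L_connected FP F'K.
have [||i fi] := f_dense.2 (cst 1) (1 / 2); [exact: cst_continuous|lra|].
have [||j fj] := f_dense.2 (cst 0) (1 / 2); [exact: cst_continuous|lra|].
have gji x : along (F (x, false)) (g j) < along (F (x, false)) (g i).
  apply: direction_map_lt FP _; rewrite /along /= !mul1r.
  by have := fi x; have := fj x; rewrite !ltr_norml /=; lra.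
have g_cont : continuous (g i \- g j).
  by move=> y; apply: cvgB; exact: g_dense.1.
have [y|pos|neg] := connected_constant_sign L_connected g_cont.
- have [x <-] := direction_map_point_surj y FP F'K.
  rewrite subr_eq0; apply: contraL (gji x).
  by rewrite /along => /eqP ->; rewrite ltxx.
- exists false => x; have := gji x; have := pos (F (x, false)).1.
  case: (F _) => z [] //=; rewrite /along /= expr1 !mulN1r; lra.
- exists true => x; have := gji x; have := neg (F (x, false)).1.
  case: (F _) => z [] //=; rewrite /along /= !mul1r; lra.
Qed.

Lemma direction_map_factor F F' : connected [set: L] ->
  direction_map f g F -> cancel F' F ->
  exists psi b, forall x c, F (x, c) = (psi x, c (+) b).
Proof.
move=> L_connected FP F'K.
have [b Fb] := direction_map_sign L_connected FP F'K.
exists (fun x => (F (x, false)).1), b => x c.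
have FE : F (x, false) = ((F (x, false)).1, b).
  by rewrite -(Fb x) -surjective_pairing.
case: c => //; rewrite -[(x, true)]/(opposite (x, false)).
by rewrite direction_map_opposite // {1}FE.
Qed.

Lemma dense_family_base (y : L) (N : set L) : nbhs y N ->
  exists i j, g j y < g i y /\ forall z, g j z < g i z -> N z.
Proof.
move=> /(compact_hausdorff_separation R L_ch).
move=> [phi phi_cont [phiy phi1]].
have [||i gi] := g_dense.2 (fun z => 1 / 2 - phi z) (1 / 4).
- by move=> z; apply: cvgB; [exact: cvg_cst|exact: phi_cont].
- lra.
have [||j gj] := g_dense.2 (cst 0) (1 / 4); [exact: cst_continuous|lra|].
exists i, j; split=> [|z].
  by have := gi y; have := gj y; rewrite phiy !ltr_norml /=; lra.
apply: contraPP => /phi1 phiz; apply/negP; rewrite -leNgt.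
by have := gi z; have := gj z; rewrite phiz !ltr_norml /=; lra.
Qed.

Lemma order_equivariant_continuous (psi : K -> L) :
  (forall i j x, f j x < f i x <-> g j (psi x) < g i (psi x)) ->
  continuous psi.
Proof.
move=> psi_lt x N /dense_family_base[i [j [ji sub_N]]].
have lt_open := open_continuous_lt (f_dense.1 j) (f_dense.1 i).
have : nbhs x [set z | f j z < f i z].
  by apply: open_nbhs_nbhs; split=> //; exact/psi_lt.
by apply: filterS => z /psi_lt /sub_N.
Qed.

End direction_maps.

Theorem proximity_homeomorphism (R : realType) (I : choiceType)
    (K L : ptopologicalType) (f : I -> K -> R) (g : I -> L -> R) (r s : R) :
  compact_hausdorff K -> compact_hausdorff L -> connected [set: L] ->
  dense_family f -> dense_family g -> 0 < r -> 0 < s ->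
  proximity r f = proximity s g ->
  exists (psi : K -> L) (b : bool), homeomorphism psi /\
    forall i j x, f j x < f i x <-> flip b g j (psi x) < flip b g i (psi x).
Proof.
move=> K_ch L_ch L_connected f_dense g_dense r_gt0 s_gt0 fg.
have [F FP] := direction_map_exists K_ch L_ch f_dense g_dense r_gt0 s_gt0 fg.
have [F' F'P] :=
  direction_map_exists L_ch K_ch g_dense f_dense s_gt0 r_gt0 (esym fg).
have FK := direction_mapK K_ch f_dense FP F'P.
have F'K := direction_mapK L_ch g_dense F'P FP.
have [psi [b FE]] :=
  direction_map_factor L_ch f_dense g_dense L_connected FP F'K.
pose psi' y := (F' (y, false)).1.
have psiK : cancel psi psi' by move=> x; rewrite /psi' -(addbb b) -FE FK.
have psi'K : cancel psi' psi.
  move=> y; rewrite /psi'; case F'y : (F' (y, false)) => [x c] /=.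
  by have := F'K (y, false); rewrite F'y FE => -[].
have psi_lt i j x : f j x < f i x <-> flip b g j (psi x) < flip b g i (psi x).
  have alongE (u : K -> R) : along (x, false) u = u x by rewrite /along mul1r.
  have := @direction_map_lt _ _ _ _ f g F (x, false) i j FP.
  have := @direction_map_lt _ _ _ _ g f F' (F (x, false)) i j F'P.
  by rewrite FK FE !alongE; split.
have flip_dense := dense_family_flip b g_dense.
exists psi, b; split=> //; split.
  exact: (order_equivariant_continuous L_ch f_dense flip_dense psi_lt).
exists psi'; split=> //.
apply: (order_equivariant_continuous K_ch flip_dense f_dense) => i j y.
by rewrite psi_lt psi'K.
Qed.

Section unit_interval.
Context (R : realType).
Local Notation K := (unit_interval R).

Lemma unit_interval_clamp_subproof (t : R) :
  Num.max 0 (Num.min 1 t) \in (`[(0 : R), (1 : R)]%classic : set R).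
Proof. by rewrite inE /= in_itv /= le_max lexx ge_max ler01 ge_min lexx. Qed.

Definition unit_interval_clamp (t : R) : K :=
  exist (fun s => s \in _) _ (unit_interval_clamp_subproof t).

HB.instance Definition _ := isPointed.Build K (unit_interval_clamp 0).

Lemma unit_interval_clamp_continuous : continuous unit_interval_clamp.
Proof.
apply: (@continuous_comp_initial K R R (fun x : K => sval x)) => t.
apply: (@continuous_max R R (cst 0) (cst 1 \min id)); first exact: cvg_cst.
by apply: (@continuous_min R R (cst 1) id); [exact: cvg_cst|exact: cvg_id].
Qed.

Lemma unit_interval_clamp_surj : unit_interval_clamp @` `[0, 1] = [set: K].
Proof.
apply/seteqP; split=> // -[t t01] _; have t_itv := set_mem t01.
exists t => //; apply: val_inj; move: t_itv; rewrite /= in_itv /=.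
by move=> /andP[t_ge0 t_le1]; rewrite min_r // max_r.
Qed.

Lemma unit_interval_compact : compact [set: K].
Proof.
rewrite -unit_interval_clamp_surj; apply: continuous_compact.
  exact/continuous_subspaceT/unit_interval_clamp_continuous.
exact: segment_compact.
Qed.

Lemma unit_interval_connected : connected [set: K].
Proof.
rewrite -unit_interval_clamp_surj; apply: connected_continuous_connected.
  exact: segment_connected.
exact/continuous_subspaceT/unit_interval_clamp_continuous.
Qed.

Lemma unit_interval_hausdorff : hausdorff_space K.
Proof.
apply: (injective_continuous_hausdorff (h := fun x : K => sval x)).
- exact: Rhausdorff.
- exact: initial_continuous.
- exact: val_inj.
Qed.

Lemma unit_interval_compact_hausdorff : compact_hausdorff K.
Proof.
by split; [exact: unit_interval_compact|exact: unit_interval_hausdorff].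
Qed.

Lemma C01_dist_lt (u v : C01 R) (r : R) :
  C01_dist u v < r <-> uniformly_within r u v.
Proof.
exact: (sup_dist_lt r unit_interval_compact (@cts_fun _ _ u) (@cts_fun _ _ v)).
Qed.

Lemma C01_dense_family (I : Type) (f : I -> C01 R) :
  C01_dense (range f) -> dense_family (fun i => f i : K -> R).
Proof.
move=> f_dense; split=> [i|u r u_cont r_gt0]; first exact: cts_fun.
have [_ [i _ <-] /C01_dist_lt fi] := f_dense (mkcts u_cont : C01 R) r r_gt0.
by exists i.
Qed.

End unit_interval.

Section almost_surely_some_event.
Context (d : measure_display) (T : measurableType d) (R : realType).
Context (P : probability T R).

Lemma negligible_geometric (B : set T) (A : nat -> set T) (q : R) :
  0 <= q < 1 -> (forall n, measurable (A n)) -> (forall n, B `<=` A n) ->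
  (forall n, P (A n) <= (q ^+ n)%:E)%E -> P.-negligible B.
Proof.
move=> /andP[q_ge0 q_lt1] mA BA PA.
have mcapA : measurable (\bigcap_n A n) by exact: bigcapT_measurable.
exists (\bigcap_n A n); split=> // [|w Bw n _]; last exact: BA.
apply/eqP; rewrite -measure_le0.
have q_cvg0 : (q ^+ n)%:E @[n --> \oo] --> 0%:E.
  by apply: cvg_EFin; [exact: nearW|apply: cvg_expr; rewrite ger0_norm].
apply: (cvge_to_ge q_cvg0); apply: nearW => n; apply: le_trans (PA n).
by apply: le_measure; rewrite ?inE //; exact: bigcap_inf.
Qed.

Context (I : choiceType) (A : I -> set T) (D : set I) (q : R).
Hypothesis mA : forall i, D i -> measurable (A i).
Hypothesis A_independent : forall s : seq I, uniq s -> [set` s] `<=` D ->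
  P (\big[setI/setT]_(i <- s) A i) = (q ^+ size s)%:E.

Lemma probability_none_and_all (s t : seq I) :
  uniq (s ++ t) -> [set` s ++ t] `<=` D ->
  P (\big[setI/setT]_(i <- s) (~` A i) `&` \big[setI/setT]_(i <- t) A i) =
  ((1 - q) ^+ size s * q ^+ size t)%:E.
Proof.
elim: s t => [|i s IH] t st_uniq stD.
  by rewrite big_nil setTI mul1r; exact: A_independent.
have perm_ist : perm_eq ((i :: s) ++ t) (s ++ i :: t).
  by rewrite -cat1s -catA perm_catCA.
have := IH (i :: t); rewrite -(perm_uniq perm_ist) => /(_ st_uniq).
have := IH t; move: st_uniq => /= /andP[_ st_uniq] /(_ st_uniq).
rewrite !big_cons.
set X := \big[setI/setT]_(j <- s) _; set Y := \big[setI/setT]_(j <- t) _.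
move=> PXY PXAY.
have Di : D i by apply: stD; exact: mem_head.
have stD' : [set` s ++ t] `<=` D.
  by move=> j jst; apply: stD; rewrite /= inE jst orbT.
have {}PXY := PXY stD'.
have {}PXAY :
    P (X `&` (A i `&` Y)) = ((1 - q) ^+ size s * q ^+ (size t).+1)%:E.
  by apply: PXAY => j /=; rewrite -(perm_mem perm_ist); exact: stD.
have mXY : measurable (X `&` Y).
  apply: measurableI; rewrite /X /Y big_seq; apply: bigsetI_measurable => j js.
    by apply/measurableC/mA/stD'; rewrite /= mem_cat js.
  by apply/mA/stD'; rewrite /= mem_cat js orbT.
have -> : ~` A i `&` X `&` Y = (X `&` Y) `\` A i.
  by rewrite -setIA setIC setDE.
rewrite measureD //; [|exact: mA|by rewrite [ltLHS]PXY ltry].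
rewrite -setIA [Y `&` _]setIC [X in (X - _)%E]PXY [X in (_ - X)%E]PXAY.
by rewrite -EFinB /= !exprS; congr EFin; ring.
Qed.

Lemma probability_none (s : seq I) : uniq s -> [set` s] `<=` D ->
  P (\big[setI/setT]_(i <- s) (~` A i)) = ((1 - q) ^+ size s)%:E.
Proof.
move=> s_uniq sD; have := @probability_none_and_all s [::].
by rewrite cats0 big_nil setIT mulr1; exact.
Qed.

Lemma ae_some_event : 0 < q <= 1 -> infinite_set D ->
  {ae P, forall w, exists2 i, D i & A i w}.
Proof.
move=> /andP[q_gt0 q_le1] D_infinite.
have /choice[s sP] n : exists s : seq I,
    [/\ size s = n, uniq s & [set` s] `<=` D].
  have [B BD nB] := infinite_set_fset n D_infinite.
  exists (take n (finmap.enum_fset B)); split; first exact: size_takel.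
    exact/take_uniq/finmap.fset_uniq.
  by move=> i /= /mem_take; exact: BD.
apply: (@negligible_geometric _
  (fun n => \big[setI/setT]_(i <- s n) (~` A i)) (1 - q)) => [|n|n|n].
- by rewrite subr_ge0 q_le1 ltrBlDr ltrDl.
- have [_ _ sD] := sP n; rewrite big_seq; apply: bigsetI_measurable => i /sD Di.
  exact/measurableC/mA.
- move=> w none; rewrite -bigcap_seq => i /= si Aiw; apply: none.
  by exists i => //; have [_ _] := sP n; apply.
- by have [sn s_uniq sD] := sP n; rewrite probability_none // sn.
Qed.

End almost_surely_some_event.

Section larg.
Context (R : realType) (d : measure_display) (T : measurableType d).
Context (P : probability T R) (V : set (C01 R)) (p : R).
Context (G : T -> rel (C01 R)) (G_larg : is_LARG P V p G).

Definition two_step_pairs (u v : C01 R) (s : seq (C01 R)) :=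
  [seq (u, z) | z <- s] ++ [seq (z, v) | z <- s].

Lemma two_step_pairs_distinct (u v : C01 R) (s : seq (C01 R)) :
  u != v -> uniq s -> u \notin s -> v \notin s ->
  distinct_pairs (two_step_pairs u v s).
Proof.
move=> uv s_uniq us vs; rewrite /distinct_pairs pairwise_cat !pairwise_map.
have all_neq c : c \notin s -> all (fun z => c != z) s.
  by move=> cs; apply/allP => z zs; apply: contraNneq cs => ->.
move: s_uniq; rewrite uniq_pairwise => s_neq; apply/and3P; split.
- apply/allrelP => _ _ /mapP[z zs ->] /mapP[y ys ->].
  have /allP/(_ y ys) /negPf uy := all_neq u us.
  by rewrite !xpair_eqE /= uy (negPf uv).
- apply: (sub_in_pairwise _ (all_neq u us) s_neq) => z y uz uy /= zy.
  by rewrite !xpair_eqE (negPf zy) (negPf uy) !andbF.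
- apply: (sub_in_pairwise _ (all_neq v vs) s_neq) => z y vz vy /= zy.
  by rewrite !xpair_eqE (negPf zy) [z == v]eq_sym (negPf vz).
Qed.

Definition larg_midpoints (u v : C01 R) : set (C01 R) :=
  [set z | larg_pair V (u, z) /\ larg_pair V (z, v)].

Lemma larg_two_step_paths_probability (u v : C01 R) (s : seq (C01 R)) :
  u != v -> uniq s -> [set` s] `<=` larg_midpoints u v ->
  P (\big[setI/setT]_(z <- s) (edge_event G (u, z) `&` edge_event G (z, v))) =
  ((p ^+ 2) ^+ size s)%:E.
Proof.
move=> uv s_uniq s_mid; have [_ _ _ PG indep] := G_larg.
have pairs e : e \in two_step_pairs u v s -> larg_pair V e.
  by rewrite mem_cat => /orP[] /mapP[z /s_mid[uz zv] ->].
have us : u \notin s by apply/negP => /s_mid[[_ _]]; rewrite eqxx.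
have vs : v \notin s by apply/negP => /s_mid[_ [_ _]]; rewrite eqxx.
have := indep _ pairs (two_step_pairs_distinct uv s_uniq us vs).
rewrite bigcap_seq big_cat !big_map /= -big_split => ->.
rewrite big_seq (eq_bigr (fun=> p%:E)) => [|e /pairs /PG //].
rewrite -big_seq prodEFin big_const_seq count_predT iter_mulr_1.
by rewrite size_cat !size_map addnn -mul2n exprM.
Qed.

Lemma larg_common_neighbour (u v : C01 R) : 0 < p < 1 -> u != v ->
  infinite_set (larg_midpoints u v) ->
  {ae P, forall w, exists2 z, V z & G w u z && G w z v}.
Proof.
move=> /andP[p_gt0 p_lt1] uv mid_infinite; have [_ _ mG _ _] := G_larg.
pose path z := edge_event G (u, z) `&` edge_event G (z, v).
have : {ae P, forall w, exists2 z, larg_midpoints u v z & path z w}.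
  apply: (ae_some_event (q := p ^+ 2)) => //.
  - by move=> z [uz zv]; apply: measurableI; exact: mG.
  - by move=> s s_uniq s_mid; exact: larg_two_step_paths_probability.
  - by rewrite exprn_gt0 // exprn_ile1 // ltW.
apply: filterS => w [z [[_ Vz _ _] _] [/= uz zv]].
by exists z => //; apply/andP.
Qed.

End larg.

Section dense_larg.
Context (R : realType) (f : nat -> C01 R).
Hypothesis f_inj : injective f.
Hypothesis f_dense : C01_dense (range f).

Lemma larg_midpoints_infinite (i j : nat) : C01_dist (f i) (f j) < 2 ->
  infinite_set (larg_midpoints (range f) (f i) (f j)).
Proof.
rewrite (_ : 2 = 1 + 1) // => /C01_dist_lt ij.
have mid_infinite := dense_intermediate (C01_dense_family f_dense)
  (@unit_interval_compact R) (@cts_fun _ _ (f i)) (@cts_fun _ _ (f j))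
  ij ltr01 ltr01.
have mid_but_ends := infinite_setD mid_infinite (finite_set2 i j).
move=> /(@finite_preimage _ _ _ f (in2W f_inj)).
apply: sub_infinite_set mid_but_ends => k [[/C01_dist_lt ik /C01_dist_lt kj]].
move=> /not_orP[/= ki kj'].
split; split=> //=; try by [exists i|exists j|exists k].
- by rewrite (inj_eq f_inj) eq_sym; exact/eqP.
- by rewrite (inj_eq f_inj); exact/eqP.
Qed.

Definition neighbours_detect_dist_lt2 (V : set (C01 R)) (E : rel (C01 R)) :=
  forall u v, V u -> V v -> u != v ->
    (C01_dist u v < 2 <-> exists2 z, V z & E u z && E z v).

Lemma larg_dist_lt2 (d : measure_display) (T : measurableType d)
    (P : probability T R) (p : R) (G : T -> rel (C01 R)) :
  is_LARG P (range f) p G -> 0 < p < 1 ->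
  {ae P, forall w, neighbours_detect_dist_lt2 (range f) (G w)}.
Proof.
move=> G_larg p01; have [_ edge_pair _ _ _] := G_larg.
have ae_neighbour i j : {ae P, forall w,
    f i != f j -> C01_dist (f i) (f j) < 2 ->
    exists2 z, range f z & G w (f i) z && G w z (f j)}.
  have [[ij dij]|not_close] := pselect (f i != f j /\ C01_dist (f i) (f j) < 2).
    apply: filterS (larg_common_neighbour G_larg p01 ij
      (larg_midpoints_infinite dij)) => w //.
  by apply: nearW => w ij dij; case: not_close.
have := ae_foralln (fun i => ae_foralln (ae_neighbour i)).
apply: filterS => w neighbour _ _ [i _ <-] [j _ <-] ij.
split=> [|[z _ /andP[iz zj]]]; first exact: neighbour.
have [_ _ _ /C01_dist_lt /= iz1] := edge_pair _ _ _ iz.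
have [_ _ _ /C01_dist_lt /= zj1] := edge_pair _ _ _ zj.
apply/C01_dist_lt => x; apply: le_lt_trans (ler_distD (z x) _ _) _.
by have := iz1 x; have := zj1 x; lra.
Qed.

End dense_larg.

Section product_ae.
Context (d1 d2 : measure_display) (R : realType).
Context (T1 : measurableType d1) (T2 : measurableType d2).

Lemma ae_product_fst (m1 : {measure set T1 -> \bar R})
    (m2 : {sigma_finite_measure set T2 -> \bar R}) (Q : T1 -> Prop) :
  {ae m1, forall w, Q w} -> {ae (m1 \x m2)%E, forall w, Q w.1}.
Proof.
move=> [N [mN N0 QN]]; exists (N `*` setT); split=> [||w /QN //].
  exact: measurableX.
by rewrite product_measure1E // [X in (X * _)%E]N0 mul0e.
Qed.

Lemma ae_product_snd (m1 : {measure set T1 -> \bar R})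
    (m2 : {sigma_finite_measure set T2 -> \bar R}) (Q : T2 -> Prop) :
  {ae m2, forall w, Q w} -> {ae (m1 \x m2)%E, forall w, Q w.2}.
Proof.
move=> [N [mN N0 QN]]; exists (setT `*` N); split=> [||w /QN //].
  exact: measurableX.
by rewrite product_measure1E // [X in (_ * X)%E]N0 mule0.
Qed.

Lemma ae_product_exists (P1 : probability T1 R) (P2 : probability T2 R)
    (Q : T1 * T2 -> Prop) :
  {ae (P1 \x P2)%E, forall w, Q w} -> exists w, Q w.
Proof.
move=> Q_ae; have P_gt0 : (0 < (P1 \x P2)%E setT)%E.
  rewrite -setXTT product_measure1E //.
  rewrite [X in (X * _)%E]probability_setT [X in (_ * X)%E]probability_setT.
  by rewrite mule1 lte01.
have P_proper := ae_properfilter_algebraOfSetsType P_gt0.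
exact: filter_ex Q_ae.
Qed.

End product_ae.

Lemma set_bij_range_reindex (I T : Type) (f g : I -> T) (phi : T -> T) :
  injective f -> injective g -> set_bij (range f) (range g) phi ->
  exists2 n : I -> I, bijective n & forall i, phi (f i) = g (n i).
Proof.
move=> f_inj g_inj [phi_fun phi_inj phi_surj].
have in_range (h : I -> T) i : range h (h i) by exists i.
have /choice[n phin] i : exists k, phi (f i) = g k.
  by have [k _ <-] := phi_fun _ (in_range f i); exists k.
have /choice[n' phin'] k : exists i, phi (f i) = g k.
  by have [_ [i _ <-] phii] := phi_surj _ (in_range g k); exists i.
exists n => //; exists n' => i; last by apply: g_inj; rewrite -phin phin'.
by apply/f_inj/phi_inj; rewrite ?inE // phin' phin.
Qed.

Lemma graph_iso_dist_lt2 (R : realType) (V W : set (C01 R))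
    (E F : rel (C01 R)) (phi : C01 R -> C01 R) :
  neighbours_detect_dist_lt2 V E -> neighbours_detect_dist_lt2 W F ->
  set_bij V W phi ->
  (forall u v, V u -> V v -> E u v = F (phi u) (phi v)) ->
  forall u v, V u -> V v ->
    C01_dist u v < 2 <-> C01_dist (phi u) (phi v) < 2.
Proof.
move=> E_dist F_dist [phi_fun phi_inj phi_surj] iso u v Vu Vv.
have [->|uv] := eqVneq u v.
  by split=> _; apply/C01_dist_lt => x; rewrite subrr normr0.
have phi_uv : phi u != phi v.
  by apply: contra_neq uv => /phi_inj; apply; rewrite inE.
rewrite (E_dist u v) // (F_dist (phi u) (phi v)) //; try exact: phi_fun.
split=> [[z Vz]|[_ /phi_surj[z Vz <-]]]; rewrite -?iso //.
  by rewrite !iso //; exists (phi z) => //; exact: phi_fun.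
by exists z.
Qed.

Theorem theorem18 (R : realType) (f g : nat -> C01 R) (p p' : R)
    (f_inj : injective f) (g_inj : injective g)
    (f_dense : C01_dense (range f)) (g_dense : C01_dense (range g))
    (hp : 0 < p < 1) (hp' : 0 < p' < 1)
    (d1 d2 : measure_display)
    (T1 : measurableType d1) (T2 : measurableType d2)
    (P1 : probability T1 R) (P2 : probability T2 R)
    (G : T1 -> rel (C01 R)) (H : T2 -> rel (C01 R))
    (G_larg : is_LARG P1 (range f) p G)
    (H_larg : is_LARG P2 (range g) p' H)
    (GH_iso : as_isomorphic P1 P2 (range f) G (range g) H) :
  exists (psi : unit_interval R -> unit_interval R) (n : nat -> nat),
    [/\ homeomorphism psi, bijective n &
        (forall (i j : nat) (x : unit_interval R),
           f i x > f j x -> g (n i) (psi x) >= g (n j) (psi x)) \/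
        (forall (i j : nat) (x : unit_interval R),
           f i x > f j x -> g (n i) (psi x) <= g (n j) (psi x))].
Proof.
have f_ae := ae_product_fst P2 (larg_dist_lt2 f_inj f_dense G_larg hp).
have g_ae := ae_product_snd P1 (larg_dist_lt2 g_inj g_dense H_larg hp').
have [w [[Gw Hw] [phi [phi_bij iso]]]] :=
  ae_product_exists (filterI (filterI f_ae g_ae) GH_iso).
have [n n_bij phin] := set_bij_range_reindex f_inj g_inj phi_bij.
have same_proximity : proximity 2 (fun i => f i : unit_interval R -> R) =
    proximity 2 ((fun i => g i : unit_interval R -> R) \o n).
  apply/funext => i; apply/funext => j; apply/propext.
  rewrite /proximity /= -!C01_dist_lt -!phin.
  by apply: graph_iso_dist_lt2 Gw Hw phi_bij iso _ _ _ _; [exists i|exists j].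
have [psi [b [psi_homeo psi_lt]]] := proximity_homeomorphism
  (@unit_interval_compact_hausdorff R) (@unit_interval_compact_hausdorff R)
  (@unit_interval_connected R) (C01_dense_family f_dense)
  (dense_family_bij n_bij (C01_dense_family g_dense))
  (ltr0n _ 2) (ltr0n _ 2) same_proximity.
exists psi, n; split=> //; case: b psi_lt => psi_lt; [right|left] => i j x;
  by move=> /psi_lt /ltW; rewrite /flip ?expr1 ?mulN1r ?lerN2 ?mul1r.
Qed.
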